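(* Let $\lambda>0$. There is a positive constant $C'$, depending possibly on $\lambda$ but independent of $v$ and $\mu$, such that for every integer $v$ and every $\mu>0$, \[\int_{\mathbf{R}}e^{-t^2}\left(\frac{(t+\lambda^2i)^2-\mu}{|(t+\lambda^2i)^2-\mu|}\right)^vK_v\big(|(t+\lambda^2i)^2-\mu|\big)\,dt=(-1)^vC'e^{-\mu}.\]
   Context: $K_v$ is the modified Bessel function of the second kind, $K_v(y)=\frac12\int_0^\infty t^ve^{-y(t+t^{-1})/2}\frac{dt}{t}$ for $y>0$. *)

(* Defs.v *)
From HB Require Import structures.
From mathcomp Require Import all_boot all_order all_algebra.
From mathcomp Require Import all_classical all_reals all_analysis.
From mathcomp Require Import complex.

Set Implicit Arguments.
Unset Strict Implicit.
Unset Printing Implicit Defensive.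

Import Order.TTheory GRing.Theory Num.Theory.

Local Open Scope classical_set_scope.
Local Open Scope ring_scope.
Local Open Scope complex_scope.

(* Only meant for 0 < y, where the integrand is integrable. *)
Definition besselK (R : realType) (v y : R) : R :=
  2^-1 * \int[@lebesgue_measure R]_(t in `]0, +oo[)
           (t `^ v * expR (- (y * (t + t^-1) / 2)) / t).

Definition cintegrable (d : measure_display) (T : measurableType d)
    (R : realType) (m : {measure set T -> \bar R}) (D : set T)
    (f : T -> R[i]) : Prop :=
  m.-integrable D (fun x => (complex.Re (f x))%:E) /\
  m.-integrable D (fun x => (complex.Im (f x))%:E).

(* Only meaningful together with [cintegrable m D f]. *)
Definition cintegral (d : measure_display) (T : measurableType d)
    (R : realType) (m : {measure set T -> \bar R}) (D : set T)
    (f : T -> R[i]) : R[i] :=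
  (\int[m]_(x in D) complex.Re (f x)) +i* (\int[m]_(x in D) complex.Im (f x)).

(* Main.v *)
Require Import Defs.
From HB Require Import structures.
From mathcomp Require Import all_boot all_order all_algebra.
From mathcomp Require Import all_classical all_reals all_analysis.
From mathcomp Require Import complex measurable_realfun ring lra.

(** Write [L = lambda ^ 2], [z = (t + i L) ^ 2 - mu] and let [F_n (mu)] be the
    integral for [v = n].  Since [z (- t)] is conjugate to [z t], the imaginary
    part of the integrand is odd in [t] and only the real part contributes;
    with [K_(-v) = K_v] this also gives [F_(-n) = F_n].  The recurrences of
    [K_v] yield, for [g_n = (z / |z|) ^ n K_n (|z|)] and the real part [x] of
    [z], [d g_n / dx = - (g_(n-1) + g_(n+1)) / 2], so differentiating under the integral sign in
    [mu] gives [F_n' = (F_(n-1) + F_(n+1)) / 2], in particular [F_0' = F_1].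
    Hence [F_0 = C' exp (- mu)] forces [F_n = (-1) ^ n C' exp (- mu)].
    For [F_0], with [q = sqrt mu], [z = (t + i L - q) (t + i L + q)] and
    [K_0 (a b) = 1/2 int exp (- (a^2 e^x + b^2 e^(-x)) / 2) dx]; after Tonelli
    the integral in [t] is Gaussian and separates the factor [exp (- mu)]. *)

Set Implicit Arguments.
Unset Strict Implicit.
Unset Printing Implicit Defensive.

Import Order.TTheory GRing.Theory Num.Theory.
Import numFieldNormedType.Exports.

Local Open Scope classical_set_scope.
Local Open Scope ring_scope.
Local Open Scope complex_scope.

(** * Integration on the real line: substitution, domination, Gaussians *)

Section integral_tools.
Context {R : realType}.
Local Notation mu := (@lebesgue_measure R).

Lemma bigcup_itvNnn : \bigcup_n `[- n%:R, n%:R]%classic = [set: R].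
Proof.
apply/seteqP; split => // x _; exists (Num.bound `|x|) => //=.
have h := archi_boundP (normr_ge0 x).
by rewrite in_itv/= -ler_norml ltW.
Qed.

Lemma nondecreasing_itvNnn :
  nondecreasing_seq (fun n => `[- n%:R, n%:R]%classic : set R).
Proof.
move=> n m nm; apply/subsetPset => x /=; rewrite !in_itv/= => /andP[a b].
by rewrite (le_trans _ a) ?lerN2 ?ler_nat// (le_trans b) ?ler_nat.
Qed.

(** The half-line is exhausted by the intervals [[expR (- n), expR n]], images of [[- n, n]].
    Substitution on each compact piece makes the two sequences of integrals agree, and monotone
    convergence passes to the limit on both sides. *)
Lemma ge0_integral_expR_subst (G : R -> R) :
  {in `]0, +oo[, continuous G} -> (forall x : R, 0 < x -> 0 <= G x) ->
  (\int[mu]_(x in `]0%R, +oo[) (G x)%:E = \int[mu]_x (G (expR x) * expR x)%:E)%E.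
Proof.
move=> cG G0.
have mG : measurable_fun `](0 : R), +oo[ G.
  apply: open_continuous_measurable_fun; first exact: interval_open.
  by move=> x /set_mem /= x0; exact: cG.
have cGe : continuous (fun x => G (expR x) * expR x).
  move=> x; apply: cvgM; last exact: continuous_expR.
  apply: continuous_comp; first exact: continuous_expR.
  by apply: cG; rewrite in_itv/= expR_gt0.
pose A n : set R := `[expR (- n%:R), expR n%:R]%classic.
have UA : \bigcup_n A n = `]0, +oo[%classic.
  apply/seteqP; split => [x [n _]|x] /=.
    by rewrite /A /= !in_itv/= andbT => /andP[+ _]; apply: lt_le_trans; exact: expR_gt0.
  rewrite in_itv/= andbT => x0.
  have : [set: R] (ln x) by [].
  rewrite -bigcup_itvNnn => -[n _] /=; rewrite in_itv/= => /andP[a b].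
  by exists n => //=; rewrite /A /= in_itv/= -[x]lnK ?posrE// !ler_expR a b.
have ndA : nondecreasing_seq A.
  move=> n m nm; apply/subsetPset => x /=; rewrite /A /= !in_itv/= => /andP[a b].
  by rewrite (le_trans _ a) ?ler_expR ?lerN2 ?ler_nat// (le_trans b) ?ler_expR ?ler_nat.
have Apos n x : A n x -> 0 < x.
  by rewrite /A/= in_itv/= => /andP[+ _]; apply: lt_le_trans; exact: expR_gt0.
have cvA : (\int[mu]_(x in A n) (G x)%:E)%E @[n --> \oo] -->
    (\int[mu]_(x in \bigcup_n A n) (G x)%:E)%E.
  apply: ge0_nondecreasing_set_cvg_integral => //.
  - by move=> n; exact: measurable_itv.
  - move=> n; apply/measurable_EFinP; apply: measurable_funS mG => //.
    by move=> x /Apos x0 /=; rewrite in_itv/= x0.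
  - by move=> n x /Apos x0; rewrite lee_fin G0.
pose B n : set R := `[- n%:R, n%:R]%classic.
have cvB : (\int[mu]_(x in B n) (G (expR x) * expR x)%:E)%E @[n --> \oo] -->
    (\int[mu]_(x in \bigcup_n B n) (G (expR x) * expR x)%:E)%E.
  apply: ge0_nondecreasing_set_cvg_integral.
  - exact: nondecreasing_itvNnn.
  - by move=> n; exact: measurable_itv.
  - move=> n; apply/measurable_EFinP/measurable_funTS.
    exact: continuous_measurable_fun.
  - by move=> n x _; rewrite lee_fin mulr_ge0 ?expR_ge0 ?G0 ?expR_gt0.
rewrite -UA -bigcup_itvNnn; apply: (cvg_unique _ cvA) => //.
apply: cvg_trans cvB; apply: near_eq_cvg; near=> n.
have dE : (@expR R)^`()%classic = @expR R.
  by apply/funext => x; rewrite derive1E derive_val.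
rewrite (@integration_by_substitution_increasing _ expR).
- by apply: eq_integral => x _; rewrite dE.
- by rewrite (@le_trans _ _ 0)// oppr_le0.
- by move=> x y _ _; rewrite ltr_expR.
- by rewrite dE => x _; exact: continuous_expR.
- by rewrite dE; apply/cvg_ex; eexists; apply: cvg_at_right_filter; exact: continuous_expR.
- by rewrite dE; apply/cvg_ex; eexists; apply: cvg_at_left_filter; exact: continuous_expR.
- split; first by move=> x _; exact: derivable_expR.
  + by apply: cvg_at_right_filter; exact: continuous_expR.
  + by apply: cvg_at_left_filter; exact: continuous_expR.
- apply: continuous_in_subspaceT => x /set_mem /Apos x0.
  by apply: cG; rewrite in_itv/= x0.
Unshelve. all: by end_near. Qed.

(** Lebesgue measure equals its own pushforward under negation. *)
Lemma integral_reflection (f : R -> R) : measurable_fun setT f ->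
  (forall x, 0 <= f x) ->
  (\int[mu]_x (f (- x))%:E = \int[mu]_x (f x)%:E)%E.
Proof.
move=> mf f0.
rewrite -[RHS](@eq_measure_integral _ _ _ _ mu
   (pushforward mu (-%R : _ -> measurableTypeR R)))//; last first.
  by move=> A mA _; exact: lebesgue_measureN.
rewrite ge0_integral_pushforward//; first exact/measurable_EFinP.
by move=> x _; rewrite lee_fin.
Qed.

Lemma integral_translation (f : R -> R) (c : R) : continuous f ->
  (forall x, 0 <= f x) ->
  (\int[mu]_x (f (x + c))%:E = \int[mu]_x (f x)%:E)%E.
Proof.
move=> cf f0.
have D1 : (fun x : R => x + c)^`()%classic = cst 1.
  by apply/funext => x; rewrite derive1E derive_val addr0.
rewrite [RHS](@increasing_ge0_integration_by_substitutionT _ (fun x => x + c) f)//.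
- by apply: eq_integral => x _; rewrite D1 !fctE/= mulr1.
- by move=> x y xy; rewrite ltrD2r.
- by rewrite D1 => x; exact: cst_continuous.
- by rewrite D1; exact: is_cvg_cst.
- by rewrite D1; exact: is_cvg_cst.
- exact: cvg_addrr_Ny.
- exact: cvg_addrr.
Qed.

Lemma continuous_integrable_dom (f g : R -> R) : continuous f ->
  (forall x, `|f x| <= g x) -> mu.-integrable setT (EFin \o g) ->
  mu.-integrable setT (EFin \o f).
Proof.
move=> cf fg ig; apply: (le_integrable _ _ _ ig) => //.
  by apply/measurable_EFinP; exact: continuous_measurable_fun.
by move=> x _ /=; rewrite lee_fin (le_trans (fg x))// ler_norm.
Qed.

(** Domination is only asked on an interval around [a], which matters for Bessel functions: no
    single majorant serves all positive arguments. *)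
Lemma is_derive_under_integral (f f' : R -> R -> R) (G : R -> R) (a u v : R) :
  u < a < v ->
  (forall x, u < x < v -> mu.-integrable setT (EFin \o f x)) ->
  (forall x y, u < x < v -> is_derive x 1 (f ^~ y) (f' x y)) ->
  (forall y, 0 <= G y) -> mu.-integrable setT (EFin \o G) ->
  (forall x y, u < x < v -> `|f' x y| <= G y) ->
  is_derive a 1 (fun x => \int[mu]_y f x y) (\int[mu]_y f' a y).
Proof.
move=> uav fi df G0 iG fG.
have Ia : `]u, v[%classic a by rewrite /= in_itv.
have pE x y : u < x < v -> partial1of2 f x y = f' x y.
  by move=> h; rewrite partial1of2E; have d := df x y h; rewrite derive_val.
apply: DeriveDef.
- apply: (@derivable_under_integral _ _ _ mu f setT measurableT a u v Ia _ _ G) => //.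
  + by move=> x y xuv _; case: (df x y xuv).
  + by move=> x y xuv _; rewrite pE ?fG.
- rewrite -derive1E (@differentiation_under_integral _ _ _ mu f setT measurableT a u v Ia _ _ G) => //.
  + by apply: eq_Rintegral => y _; rewrite pE.
  + by move=> x y xuv _; case: (df x y xuv).
  + by move=> x y xuv _; rewrite pE ?fG.
Qed.

(** On [[- n, n]] the fundamental theorem leaves boundary terms that tend to 0, while dominated
    convergence with majorant [|f|] sends the truncated integrals to the full one. *)
Lemma Rintegral_derivative0 (f F : R -> R) :
  continuous f -> (forall x : R, is_derive x 1 F (f x)) ->
  mu.-integrable setT (EFin \o f) ->
  F n%:R @[n --> \oo] --> 0 -> F (- n%:R) @[n --> \oo] --> 0 ->
  \int[mu]_x f x = 0.
Proof.
move=> cf dF fi Fp Fm.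
have cF : continuous F.
  by move=> x; apply/differentiable_continuous/derivable1_diffP; case: (dF x).
have cvI : (\int[mu]_x ((f \_ `[- n%:R, n%:R]) x)%:E)%E @[n --> \oo] -->
   (\int[mu]_x (f x)%:E)%E.
  apply: (@dominated_cvg _ _ _ mu setT measurableT
    (fun n x => ((f \_ `[- n%:R, n%:R]) x)%:E) (EFin \o f) (fun x => `|f x|%:E)) => //=.
  - move=> n; apply/measurable_EFinP/(measurable_restrictT _ _).1 => //.
    by apply/measurable_funTS; exact: continuous_measurable_fun.
  - move=> x _; apply: cvg_near_cst; near=> n; congr EFin.
    rewrite patchE mem_set//= in_itv/= -ler_norml ltW//.
    near: n; exact: nbhs_infty_gtr.
  - exact: integrable_norm.
  - move=> n x _; rewrite lee_fin patchE; case: ifP => // _.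
    by rewrite normr0.
have cv0 : (\int[mu]_x ((f \_ `[- n%:R, n%:R]) x)%:E)%E @[n --> \oo] --> (0 : \bar R)%E.
  have : (F n%:R - F (- n%:R)) @[n --> \oo] --> (0 - 0 : R) by exact: cvgB.
  rewrite subr0 => Fc; have : (F n%:R - F (- n%:R))%:E @[n --> \oo] --> (0 : R)%:E.
    by apply: cvg_EFin => //; exact: nearW.
  apply: cvg_trans; apply: near_eq_cvg; near=> n => /=.
  rewrite [RHS](_ : _ = \int[mu]_(x in `[(- n%:R)%R, n%:R%R]) (f x)%:E)%E; last first.
    rewrite [RHS]integral_mkcond; apply: eq_integral => x _.
    by rewrite !patchE; case: ifP.
  rewrite (@continuous_FTC2 _ f F).
  - by rewrite EFinB.
  - have n0 : (0 : R) < n%:R by rewrite ltr0n; near: n; exact: nbhs_infty_gt.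
    by lra.
  - exact: continuous_subspaceT.
  - split; first by move=> x _; case: (dF x).
    + exact/cvg_at_right_filter/cF.
    + exact/cvg_at_left_filter/cF.
  - by move=> x _; rewrite derive1E; have d := dF x; rewrite derive_val.
by rewrite /Rintegral (cvg_unique _ cvI cv0).
Unshelve. all: by end_near. Qed.

Lemma integral_gaussian (a m : R) : 0 < a ->
  (\int[mu]_x (expR (- (a * (x - m) ^+ 2)))%:E = (Num.sqrt (pi / a))%:E)%E.
Proof.
(* The standard deviation for which [a * (x - m) ^+ 2] is the exponent of the normal density; the
   integral is then the inverse of its peak value. *)
move=> a0; pose s := (Num.sqrt (2 * a))^-1.
have s0 : s != 0 by rewrite invr_eq0 gt_eqF// sqrtr_gt0; lra.
have s2 : s ^+ 2 = (2 * a)^-1 by rewrite exprVn sqr_sqrtr//; lra.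
have pk : (normal_peak s)^-1 = Num.sqrt (pi / a).
  by rewrite /normal_peak invrK s2; congr Num.sqrt; rewrite -mulr_natr; field; lra.
have pk0 : normal_peak s != 0 by rewrite gt_eqF// normal_peak_gt0.
have E x : expR (- (a * (x - m) ^+ 2)) = (normal_peak s)^-1 * normal_pdf m s x.
  rewrite normal_pdfE// mulrA mulVf// mul1r /normal_fun s2.
  by congr expR; rewrite -mulr_natr; field; lra.
under eq_integral do rewrite E EFinM.
rewrite integralZl//; last exact: integrable_normal_pdf.
by rewrite integral_normal_pdf mule1 pk.
Qed.

Lemma integrable_gaussian (a m : R) : 0 < a ->
  mu.-integrable setT (fun x => (expR (- (a * (x - m) ^+ 2)))%:E).
Proof.
move=> a0; apply/integrableP; split.
  apply/measurable_EFinP; apply: measurableT_comp => //.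
  apply: measurableT_comp => //; apply: measurable_funM => //.
  by apply: measurable_funX; exact: measurable_funB.
under eq_integral do rewrite /= ger0_norm ?expR_ge0//.
by rewrite integral_gaussian// ltry.
Qed.

Lemma integrable_EFinD (f g : R -> R) : mu.-integrable setT (EFin \o f) ->
  mu.-integrable setT (EFin \o g) ->
  mu.-integrable setT (EFin \o (fun x => f x + g x)).
Proof.
move=> fi gi; rewrite (_ : EFin \o _ = (EFin \o f) \+ (EFin \o g))%E.
  exact: integrableD.
exact/funext.
Qed.

Lemma integrable_EFinZ (c : R) (f : R -> R) : mu.-integrable setT (EFin \o f) ->
  mu.-integrable setT (EFin \o (fun x => c * f x)).
Proof.
move=> fi; rewrite (_ : EFin \o _ = fun x => c%:E * (EFin \o f) x)%E.
  exact: integrableZl.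
exact/funext.
Qed.

Lemma integrable_EFinB (f g : R -> R) : mu.-integrable setT (EFin \o f) ->
  mu.-integrable setT (EFin \o g) ->
  mu.-integrable setT (EFin \o (fun x => f x - g x)).
Proof.
move=> fi gi; rewrite (_ : EFin \o _ = (EFin \o f) \- (EFin \o g))%E.
  exact: integrableB.
exact/funext.
Qed.

End integral_tools.

(** * Derivative rules for functions written out explicitly *)

Section real_derivatives.
Context {R : realType}.
Implicit Types (f g : R -> R) (x : R).

Lemma is_derive_add f g x df dg : is_derive x 1 f df -> is_derive x 1 g dg ->
  is_derive x 1 (fun t => f t + g t) (df + dg).
Proof. by move=> hf hg; exact: is_deriveD. Qed.

Lemma is_derive_opp f x df : is_derive x 1 f df ->
  is_derive x 1 (fun t => - f t) (- df).
Proof. by move=> hf; exact: is_deriveN. Qed.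

Lemma is_derive_mul f g x df dg : is_derive x 1 f df -> is_derive x 1 g dg ->
  is_derive x 1 (fun t => f t * g t) (f x * dg + g x * df).
Proof. by move=> hf hg; exact: is_deriveM. Qed.

Lemma is_derive_scale (k : R) f x df : is_derive x 1 f df ->
  is_derive x 1 (fun t => k * f t) (k * df).
Proof. by move=> hf; exact: is_deriveZ. Qed.

Lemma is_derive_const (k : R) x : is_derive x 1 (fun=> k) (0 : R).
Proof. exact: is_derive_cst. Qed.

Lemma is_derive_chain f g x df dg : is_derive x 1 f df ->
  is_derive (f x) 1 g dg -> is_derive x 1 (fun t => g (f t)) (dg * df).
Proof. by move=> hf hg; exact: is_derive1_comp. Qed.

Lemma is_derive_exp_comp f x df : is_derive x 1 f df ->
  is_derive x 1 (fun t => expR (f t)) (expR (f x) * df).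
Proof. by move=> hf; exact: (is_derive_chain hf (is_derive_expR _)). Qed.

Lemma is_derive_continuous f x df : is_derive x 1 f df -> {for x, continuous f}.
Proof. by move=> [df' _]; exact/differentiable_continuous/derivable1_diffP. Qed.

End real_derivatives.

(** * The Bessel function [K_v]: cosh representation, derivative, recurrence *)

Section besselK_theory.
Context {R : realType}.
Local Notation mu := (@lebesgue_measure R).

Implicit Types v y x : R.

(** This is [exp (v x - y cosh x)], obtained from the defining integral by [t = exp x]. Changing the
    order by 1 becomes multiplication by [exp x] or [exp (- x)]. *)
Definition besselK_integrand (v y x : R) :=
  expR (v * x - y * ((expR x + expR (- x)) / 2)).
Local Notation k := besselK_integrand.

Lemma besselK_integrand_gt0 v y x : 0 < k v y x.
Proof. exact: expR_gt0. Qed.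

Lemma besselK_integrandS v y x : k (v + 1) y x = expR x * k v y x.
Proof. by rewrite -expRD; congr expR; ring. Qed.

Lemma besselK_integrandB v y x : k (v - 1) y x = expR (- x) * k v y x.
Proof. by rewrite -expRD; congr expR; ring. Qed.

(** The factor [sinh x] produced by differentiation is a half-difference of order shifts;
    integrating this identity over the line yields the recurrence of [K_v]. *)
Lemma is_derive_besselK_integrand v y x :
  is_derive x 1 (k v y) (v * k v y x - y / 2 * (k (v + 1) y x - k (v - 1) y x)).
Proof.
apply: is_derive_eq; rewrite /GRing.scale/=.
rewrite besselK_integrandS besselK_integrandB -/(k v y x).
by field.
Qed.

Lemma continuous_besselK_integrand v y : continuous (k v y).
Proof. by move=> x; exact: is_derive_continuous (is_derive_besselK_integrand v y x). Qed.

(** Here differentiation produces [- cosh x], a half-sum of order shifts. *)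
Lemma is_derive_besselK_integrand_param v y x :
  is_derive y 1 (fun y => k v y x) (- ((k (v + 1) y x + k (v - 1) y x) / 2)).
Proof.
apply: is_derive_eq; rewrite /GRing.scale/=.
rewrite besselK_integrandS besselK_integrandB -/(k v y x).
by field.
Qed.

(** For [t >= 0], [exp t = exp (t / 2) ^ 2 >= (1 + t / 2) ^ 2 >= t ^ 2 / 4]; this crude bound is
    what gives the integrand a Gaussian majorant. *)
Lemma sqr_le_cosh (x : R) : x ^+ 2 / 4 <= expR x + expR (- x).
Proof.
have pos t : 0 <= t -> t ^+ 2 / 4 <= expR t :> R.
  move=> t0; have -> : t = t / 2 + t / 2 by field.
  rewrite expRD; have := expR_ge1Dx (t / 2); set e := expR _ => h.
  have -> : (t / 2 + t / 2) ^+ 2 / 4 = (t / 2) * (t / 2) by field.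
  by apply: ler_pM; lra.
have [x0|x0] := leP 0 x; first by have := pos _ x0; have := expR_gt0 (- x); lra.
have nx : 0 <= - x by lra.
by have := pos _ nx; rewrite sqrrN; have := expR_gt0 x; lra.
Qed.

(** Replace cosh by its quadratic lower bound and complete the square in [x]. *)
Lemma besselK_integrand_gaussian v y x : 0 < y ->
  k v y x <= expR (2 * v ^+ 2 / y) * expR (- (y / 8 * (x - 4 * v / y) ^+ 2)).
Proof.
move=> y0; rewrite -expRD ler_expR.
have -> : 2 * v ^+ 2 / y - y / 8 * (x - 4 * v / y) ^+ 2 = v * x - y * (x ^+ 2 / 4 / 2).
  by field; lra.
by rewrite lerD2l lerN2 ler_pM2l// ler_pM2r ?invr_gt0//; exact: sqr_le_cosh.
Qed.

Lemma besselK_integrand_bounded v y x : 0 < y -> k v y x <= expR (2 * v ^+ 2 / y).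
Proof.
move=> y0; apply: (le_trans (besselK_integrand_gaussian v x y0)).
rewrite ler_piMr ?expR_ge0// -[leRHS]expR0 ler_expR oppr_le0.
by rewrite mulr_ge0 ?sqr_ge0//; lra.
Qed.

Lemma integrable_besselK_integrand v y : 0 < y ->
  mu.-integrable setT (EFin \o k v y).
Proof.
move=> y0.
apply: (continuous_integrable_dom (@continuous_besselK_integrand v y)
  (g := fun x => expR (2 * v ^+ 2 / y) * expR (- (y / 8 * (x - 4 * v / y) ^+ 2)))).
  by move=> x; rewrite gtr0_norm ?besselK_integrand_gt0//; exact: besselK_integrand_gaussian.
by apply: integrable_EFinZ; apply: integrable_gaussian; lra.
Qed.

Lemma besselKE v y : besselK v y = 2^-1 * \int[mu]_x k v y x.
Proof.
rewrite /besselK /Rintegral; congr (_ * fine _).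
rewrite (@ge0_integral_expR_subst _
  (fun t => t `^ v * expR (- (y * (t + t^-1) / 2)) / t)).
- apply: eq_integral => x _; congr EFin.
  rewrite mulfVK ?gt_eqF ?expR_gt0// -expRM -expRD -expRN; congr expR.
  by field.
- move=> t; rewrite in_itv/= andbT => t0.
  have ct : {for t, continuous (fun s : R => s^-1)}.
    by apply: inv_continuous; rewrite gt_eqF.
  apply: cvgM; last exact: ct.
  apply: cvgM.
    exact: (is_derive_continuous (is_derive1_powR v t0)).
  apply: continuous_comp; last exact: continuous_expR.
  apply: cvgN; apply: cvgM; last exact: cvg_cst.
  apply: cvgM; first exact: cvg_cst.
  by apply: cvgD; [exact: cvg_id|exact: ct].
- move=> t t0; rewrite mulr_ge0 ?invr_ge0 ?(ltW t0)// mulr_ge0 ?expR_ge0//.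
  exact: powR_ge0.
Qed.

Lemma besselK_ge0 v y : 0 <= besselK v y.
Proof.
rewrite besselKE mulr_ge0// ?invr_ge0//; apply: Rintegral_ge0 => // x _.
exact/ltW/besselK_integrand_gt0.
Qed.

Lemma besselKN v y : besselK (- v) y = besselK v y.
Proof.
rewrite !besselKE; congr (_ * _); rewrite /Rintegral; congr fine.
rewrite -(@integral_reflection _ (k v y)).
- by apply: eq_integral => x _; congr EFin; congr expR; rewrite opprK; ring.
- by apply: continuous_measurable_fun; exact: continuous_besselK_integrand.
- by move=> x; exact/ltW/besselK_integrand_gt0.
Qed.

Lemma le_besselK_integrand v y y' x : y <= y' -> k v y' x <= k v y x.
Proof.
move=> yy'; by rewrite ler_expR lerD2l lerN2 ler_wpM2r.
Qed.

Lemma le_besselK v y y' : 0 < y -> y <= y' -> besselK v y' <= besselK v y.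
Proof.
move=> y0 yy'; rewrite !besselKE ler_pM2l ?invr_gt0//.
apply: le_Rintegral => //.
- by apply: integrable_besselK_integrand; lra.
- exact: integrable_besselK_integrand.
- by move=> x _; exact: le_besselK_integrand.
Qed.

Lemma is_derive_besselK v y : 0 < y ->
  is_derive y 1 (besselK v) (- ((besselK (v + 1) y + besselK (v - 1) y) / 2)).
Proof.
move=> y0.
have -> : besselK v = fun y => 2^-1 * \int[mu]_x k v y x.
  by apply/funext => z; rewrite besselKE.
apply: is_derive_eq.
  apply: is_derive_scale.
  (* The integrands decrease in [y], so on []y / 2, 2 * y[] their values at [y / 2] dominate. *)
  apply: (@is_derive_under_integral _ (fun y x => k v y x)
    (fun y x => - ((k (v + 1) y x + k (v - 1) y x) / 2))
    (fun x => k (v + 1) (y / 2) x + k (v - 1) (y / 2) x) _ (y / 2) (2 * y)).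
  - by apply/andP; split; lra.
  - by move=> z /andP[z0 _]; apply: integrable_besselK_integrand; lra.
  - by move=> z x _; exact: is_derive_besselK_integrand_param.
  - by move=> x; rewrite addr_ge0// ltW// besselK_integrand_gt0.
  - by apply: integrable_EFinD; apply: integrable_besselK_integrand; lra.
  - move=> z x /andP[z0 _]; rewrite normrN ger0_norm; last first.
      by rewrite divr_ge0// addr_ge0// ltW// besselK_integrand_gt0.
    have h w := le_besselK_integrand w x (ltW z0).
    have := h (v + 1); have := h (v - 1).
    have := besselK_integrand_gt0 (v + 1) z x.
    by have := besselK_integrand_gt0 (v - 1) z x; lra.
have i w := integrable_besselK_integrand w y0.
rewrite !besselKE.
transitivity (2^-1 * (- 2^-1 * (\int[mu]_x k (v + 1) y x + \int[mu]_x k (v - 1) y x))).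
  congr (_ * _); rewrite -RintegralD// -RintegralZl//.
    by apply: eq_Rintegral => x _; field.
  by apply: integrable_EFinD; exact: i.
by field.
Qed.

Lemma cvg_bounded_mul_expRN (u : nat -> R) (B : R) : (forall n, 0 <= u n <= B) ->
  expR (- n%:R) * u n @[n --> \oo] --> (0 : R).
Proof.
move=> uB.
have e0 : expR (- n%:R) @[n --> \oo] --> (0 : R).
  by apply: (@cvg_comp _ _ _ (fun n : nat => n%:R : R) (fun x => expR (- x)) _ _ _ (@cvgr_idn R)); exact: cvgr_expR.
apply: (@squeeze_cvgr _ _ _ _ (fun=> 0) (fun n => expR (- n%:R) * B)).
- apply: nearW => n; have /andP[u0 uB'] := uB n.
  by rewrite mulr_ge0 ?expR_ge0//= ler_pM2l ?expR_gt0.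
- exact: cvg_cst.
- by rewrite -[X in _ --> X](mul0r B); apply: cvgMl.
Qed.

(** The derivative of the integrand in [x] has integral 0 over the line; expanding that integral
    gives the relation. *)
Lemma besselK_recurrence v y : 0 < y ->
  y * (besselK (v + 1) y - besselK (v - 1) y) = 2 * v * besselK v y.
Proof.
move=> y0.
have i w := integrable_besselK_integrand w y0.
have c w := @continuous_besselK_integrand w y.
have : \int[mu]_x (v * k v y x - y / 2 * (k (v + 1) y x - k (v - 1) y x)) = 0.
  apply: (@Rintegral_derivative0 _ _ (k v y)).
  - move=> x; apply: cvgB; apply: cvgM; try exact: cvg_cst; first exact: c.
    by apply: cvgB; exact: c.
  - by move=> x; exact: is_derive_besselK_integrand.
  - apply: integrable_EFinB; apply: integrable_EFinZ; first exact: i.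
    by apply: integrable_EFinB; exact: i.
  (* Writing order [v] through order [v + 1] at [x = n], and through [v - 1] at [x = - n], extracts
     a factor [exp (- n)]; what remains is bounded. *)
  - under eq_fun => n.
      rewrite -[v in k v](addrK 1) besselK_integrandB; over.
    apply: (@cvg_bounded_mul_expRN _ (expR (2 * (v + 1) ^+ 2 / y))) => n.
    by rewrite ltW ?besselK_integrand_gt0// besselK_integrand_bounded.
  - under eq_fun => n.
      rewrite -[v in k v](subrK 1) besselK_integrandS; over.
    apply: (@cvg_bounded_mul_expRN _ (expR (2 * (v - 1) ^+ 2 / y))) => n.
    by rewrite ltW ?besselK_integrand_gt0// besselK_integrand_bounded.
rewrite RintegralB//=; last 2 first.
- by apply: integrable_EFinZ; exact: i.
- by apply: integrable_EFinZ; apply: integrable_EFinB; exact: i.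
have -> : \int[mu]_x (v * k v y x) = v * \int[mu]_x k v y x.
  by apply: RintegralZl => //; exact: i.
have -> : \int[mu]_x (y / 2 * (k (v + 1) y x - k (v - 1) y x)) =
    y / 2 * \int[mu]_x (k (v + 1) y x - k (v - 1) y x).
  by apply: RintegralZl => //; apply: integrable_EFinB; exact: i.
have -> : \int[mu]_x (k (v + 1) y x - k (v - 1) y x) =
    \int[mu]_x k (v + 1) y x - \int[mu]_x k (v - 1) y x.
  by apply: RintegralB => //; exact: i.
by rewrite !besselKE => h; lra.
Qed.

End besselK_theory.

(** * Powers of [z / |z|] and the modes [Re ((z / |z|) ^ n) K_n (|z|)] *)

Section angular_part.
Context {R : realType}.
Implicit Types (c s x y : R) (n : nat).

(* On the unit circle, [c = cos a] and [s = sin a], these are [cos (n a)] and [sin (n a)]. *)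
Definition cos_mul n c s := complex.Re ((c +i* s) ^+ n).
Definition sin_mul n c s := complex.Im ((c +i* s) ^+ n).

Lemma cos_mul0 c s : cos_mul 0 c s = 1. Proof. by []. Qed.

Lemma sin_mul0 c s : sin_mul 0 c s = 0. Proof. by []. Qed.

Lemma cos_mulS n c s : cos_mul n.+1 c s = c * cos_mul n c s - s * sin_mul n c s.
Proof. by rewrite /cos_mul /sin_mul exprS; case: (_ ^+ n). Qed.

Lemma sin_mulS n c s : sin_mul n.+1 c s = c * sin_mul n c s + s * cos_mul n c s.
Proof. by rewrite /cos_mul /sin_mul exprS; case: (_ ^+ n). Qed.

Lemma cos_mul1 c s : cos_mul 1 c s = c.
Proof. by rewrite cos_mulS cos_mul0 sin_mul0 mulr0 subr0 mulr1. Qed.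

Lemma cos_mul_sin_mul_sqr n c s : c ^+ 2 + s ^+ 2 = 1 ->
  cos_mul n c s ^+ 2 + sin_mul n c s ^+ 2 = 1.
Proof.
move=> cs; elim: n => [|n IH]; first by rewrite cos_mul0 sin_mul0; ring.
rewrite cos_mulS sin_mulS -[RHS]mulr1 -{1}cs -IH; ring.
Qed.

Lemma norm_cos_mul_le1 n c s : c ^+ 2 + s ^+ 2 = 1 -> `|cos_mul n c s| <= 1.
Proof.
move=> /(cos_mul_sin_mul_sqr n) h; rewrite ler_norml; apply/andP; split; nra.
Qed.

Lemma norm_sin_mul_le1 n c s : c ^+ 2 + s ^+ 2 = 1 -> `|sin_mul n c s| <= 1.
Proof.
move=> /(cos_mul_sin_mul_sqr n) h; rewrite ler_norml; apply/andP; split; nra.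
Qed.

Lemma cos_mulNs n c s : cos_mul n c (- s) = cos_mul n c s /\
  sin_mul n c (- s) = - sin_mul n c s.
Proof.
elim: n => [|n [IHc IHs]]; first by rewrite !cos_mul0 !sin_mul0 oppr0.
by rewrite !cos_mulS !sin_mulS IHc IHs; split; ring.
Qed.

Lemma cos_mul_continuous n (c s : R -> R) t : {for t, continuous c} ->
  {for t, continuous s} ->
  {for t, continuous (fun t => cos_mul n (c t) (s t))} /\
  {for t, continuous (fun t => sin_mul n (c t) (s t))}.
Proof.
move=> cc cs; elim: n => [|n [IHc IHs]].
  by split; exact: cvg_cst.
split.
- rewrite (_ : (fun t => _) = (fun t => c t * cos_mul n (c t) (s t) -
      s t * sin_mul n (c t) (s t))); last by apply/funext => u; rewrite cos_mulS.
  by apply: cvgB; apply: cvgM.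
- rewrite (_ : (fun t => _) = (fun t => c t * sin_mul n (c t) (s t) +
      s t * cos_mul n (c t) (s t))); last by apply/funext => u; rewrite sin_mulS.
  by apply: cvgD; apply: cvgM.
Qed.

(** The hypotheses say that the angle of [(c, s)] turns at rate [- w], so its [n]-fold multiple
    turns at rate [- n w]. Both parts go through one induction, as the addition formulas couple
    them. *)
Lemma is_derive_cos_mul n (c s : R -> R) (w t : R) :
  is_derive t 1 c (w * s t) -> is_derive t 1 s (- (w * c t)) ->
  is_derive t 1 (fun t => cos_mul n (c t) (s t)) (n%:R * w * sin_mul n (c t) (s t)) /\
  is_derive t 1 (fun t => sin_mul n (c t) (s t)) (- (n%:R * w * cos_mul n (c t) (s t))).
Proof.
move=> dc ds; elim: n => [|n [IHc IHs]].
  by split; apply: (is_derive_eq (is_derive_const _ t)); rewrite !mul0r ?oppr0.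
split.
- rewrite (_ : (fun t => _) = (fun t => c t * cos_mul n (c t) (s t) +
      - (s t * sin_mul n (c t) (s t)))); last by apply/funext => u; rewrite cos_mulS.
  apply: (is_derive_eq (is_derive_add (is_derive_mul dc IHc)
    (is_derive_opp (is_derive_mul ds IHs)))).
  by rewrite sin_mulS -natr1; ring.
- rewrite (_ : (fun t => _) = (fun t => c t * sin_mul n (c t) (s t) +
      s t * cos_mul n (c t) (s t))); last by apply/funext => u; rewrite sin_mulS.
  apply: (is_derive_eq (is_derive_add (is_derive_mul dc IHs) (is_derive_mul ds IHc))).
  by rewrite cos_mulS -natr1; ring.
Qed.

Definition modulus x y := Num.sqrt (x ^+ 2 + y ^+ 2).

Lemma modulusN x y : modulus x (- y) = modulus x y.
Proof. by rewrite /modulus sqrrN. Qed.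

Lemma sqr_modulus x y : modulus x y ^+ 2 = x ^+ 2 + y ^+ 2.
Proof. by rewrite sqr_sqrtr// addr_ge0 ?sqr_ge0. Qed.

Lemma unit_direction x y : 0 < modulus x y ->
  (x / modulus x y) ^+ 2 + (y / modulus x y) ^+ 2 = 1.
Proof.
move=> r0; have := sqr_modulus x y; set r := modulus x y in r0 *.
by move=> h; rewrite !expr_div_n -mulrDl -h divff// gt_eqF// exprn_gt0.
Qed.

Lemma is_derive_modulus x y : 0 < modulus x y ->
  is_derive x 1 (fun x => modulus x y) (x / modulus x y).
Proof.
move=> r0; have d0 : 0 < x ^+ 2 + y ^+ 2 by rewrite -sqr_modulus exprn_gt0.
have dq : is_derive x 1 (fun x => x ^+ 2 + y ^+ 2) (2 * x).
  by apply: is_derive_eq; rewrite /GRing.scale/=; ring.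
apply: (is_derive_eq (is_derive_chain dq (is_derive1_sqrt d0))).
by rewrite -/(modulus x y); field; rewrite gt_eqF.
Qed.

(** The angle of [x + i y] has derivative [- y / r ^ 2] in [x]; the form matches the hypotheses of
    [is_derive_cos_mul]. *)
Lemma is_derive_direction x y : 0 < modulus x y ->
  is_derive x 1 (fun x => x / modulus x y)
    (y / modulus x y ^+ 2 * (y / modulus x y)) /\
  is_derive x 1 (fun x => y / modulus x y)
    (- (y / modulus x y ^+ 2 * (x / modulus x y))).
Proof.
move=> r0; have rn : modulus x y != 0 by rewrite gt_eqF.
have dV : is_derive x 1 (fun x => (modulus x y)^-1)
    (- (modulus x y ^- 2) * (x / modulus x y)).
  have [dm dme] := is_derive_modulus r0.
  by split; [exact: derivableV|rewrite deriveV// dme].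
split.
- apply: (is_derive_eq (is_derive_mul (is_derive_id x 1) dV)).
  have := sqr_modulus x y; set r := modulus x y in rn * => h.
  have -> : y / r ^+ 2 * (y / r) = y ^+ 2 / r ^+ 3 by field.
  have -> : y ^+ 2 = r ^+ 2 - x ^+ 2 by rewrite h; ring.
  by field.
- by apply: (is_derive_eq (is_derive_scale y dV)); field.
Qed.

(* [Re ((z / |z|) ^ n) K_n(|z|)] at [z = x + i y]. *)
Definition besselK_mode n y x :=
  cos_mul n (x / modulus x y) (y / modulus x y) * besselK n%:R (modulus x y).

(** The angular derivative contributes [(n + 1) K_(n+1) / r], which the recurrence turns into
    [(K_(n+2) - K_n) / 2]; the radial one contributes [- (K_(n+2) + K_n) / 2]. The addition formulas
    regroup these into the neighbouring modes. *)
Lemma is_derive_besselK_modeS n x y : 0 < modulus x y ->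
  is_derive x 1 (besselK_mode n.+1 y)
    (- ((besselK_mode n y x + besselK_mode n.+2 y x) / 2)).
Proof.
move=> r0; have rn : modulus x y != 0 by rewrite gt_eqF.
have [dc ds] := is_derive_direction r0.
have [dC _] := is_derive_cos_mul n.+1 dc ds.
apply: (is_derive_eq (is_derive_mul dC (is_derive_chain (is_derive_modulus r0)
  (is_derive_besselK n.+1%:R r0)))).
have := besselK_recurrence n.+1%:R r0.
rewrite /besselK_mode.
have -> : n.+1%:R - 1 = n%:R :> R by rewrite -natr1 addrK.
rewrite natr1 (cos_mulS n.+1) => rec.
have := unit_direction r0.
have -> : y / modulus x y ^+ 2 = (y / modulus x y) / modulus x y by field.
set r := modulus x y in rn r0 rec *.
set c := x / r; set s := y / r => cs.
(* Rotating back by one angle expresses order [n] through order [n + 1]; this uses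
   [c ^ 2 + s ^ 2 = 1]. *)
have {1}-> : cos_mul n c s = c * cos_mul n.+1 c s + s * sin_mul n.+1 c s.
  by rewrite cos_mulS sin_mulS -[LHS]mul1r -cs; ring.
have -> : besselK n.+2%:R r = besselK n%:R r + 2 * n.+1%:R * besselK n.+1%:R r / r.
  by rewrite -rec; field.
by field.
Qed.

(** The neighbouring orders are 1 and -1, and [K_(-1) = K_1] merges them. *)
Lemma is_derive_besselK_mode0 x y : 0 < modulus x y ->
  is_derive x 1 (besselK_mode 0 y) (- besselK_mode 1 y x).
Proof.
move=> r0.
have -> : besselK_mode 0 y = fun x => besselK 0 (modulus x y).
  by apply/funext => t; rewrite /besselK_mode cos_mul0 mul1r.
apply: (is_derive_eq (is_derive_chain (is_derive_modulus r0) (is_derive_besselK 0 r0))).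
rewrite add0r sub0r besselKN /besselK_mode cos_mul1.
by field; rewrite gt_eqF.
Qed.

Lemma norm_besselK_mode_le n x y r : 0 < r -> r <= modulus x y ->
  `|besselK_mode n y x| <= besselK n%:R r.
Proof.
move=> r0 rm; have m0 := lt_le_trans r0 rm.
rewrite normrM (ger0_norm (besselK_ge0 _ _)).
rewrite (le_trans _ (le_besselK n%:R r0 rm))// ler_piMl ?besselK_ge0//.
exact/norm_cos_mul_le1/unit_direction.
Qed.

End angular_part.

(** * The integrals [F_n] and their differential relations in [m] *)

Section mode_integrals.
Context {R : realType}.
Local Notation mu := (@lebesgue_measure R).
Implicit Types (L m t : R) (n : nat).

(* Real and imaginary parts of [(t + i L) ^+ 2 - m]. *)
Definition paraRe L m t := t ^+ 2 - L ^+ 2 - m.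
Definition paraIm L t := 2 * t * L.

(** The squared modulus exceeds [L ^ 4] by nonnegative terms. Being uniform in [t] and [m], the
    bound keeps [K_n] away from its singularity at 0 and yields all the majorants below. *)
Lemma modulus_para_ge L m t : 0 <= L -> 0 <= m ->
  L ^+ 2 <= modulus (paraRe L m t) (paraIm L t).
Proof.
move=> L0 m0; rewrite -[L ^+ 2]ger0_norm ?sqr_ge0// -sqrtr_sqr ler_wsqrtr//.
have -> : paraRe L m t ^+ 2 + paraIm L t ^+ 2 = (L ^+ 2) ^+ 2 +
    ((t ^+ 2 - m) ^+ 2 + 2 * (L ^+ 2 * (t ^+ 2 + m))).
  by rewrite /paraRe /paraIm; ring.
rewrite lerDl addr_ge0 ?sqr_ge0// mulr_ge0// mulr_ge0 ?sqr_ge0//.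
by rewrite addr_ge0 ?sqr_ge0.
Qed.

Lemma modulus_para_gt0 L m t : 0 < L -> 0 <= m ->
  0 < modulus (paraRe L m t) (paraIm L t).
Proof.
move=> L0 m0; apply: (lt_le_trans _ (modulus_para_ge t (ltW L0) m0)).
exact: exprn_gt0.
Qed.

Definition mode_re L n m t :=
  expR (- t ^+ 2) * besselK_mode n (paraIm L t) (paraRe L m t).

Definition mode_im L n m t :=
  let r := modulus (paraRe L m t) (paraIm L t) in
  expR (- t ^+ 2) * (sin_mul n (paraRe L m t / r) (paraIm L t / r) * besselK n%:R r).

Lemma continuous_para L m : 0 < L -> 0 <= m ->
  let r t := modulus (paraRe L m t) (paraIm L t) in
  [/\ continuous r, continuous (fun t => paraRe L m t / r t) &
      continuous (fun t => paraIm L t / r t)].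
Proof.
move=> L0 m0 r.
have cX : continuous (paraRe L m).
  move=> t; apply: cvgB; last exact: cvg_cst.
  by apply: cvgB; [exact: exprn_continuous|exact: cvg_cst].
have cY : continuous (paraIm L).
  move=> t; apply: cvgM; last exact: cvg_cst.
  by apply: cvgM; [exact: cvg_cst|exact: cvg_id].
have cr : continuous r.
  move=> t; apply: continuous_comp; last exact: sqrt_continuous.
  apply: cvgD.
  - by apply: (@continuous_comp _ _ _ (paraRe L m) (fun x => x ^+ 2));
      [exact: cX|exact: exprn_continuous].
  - by apply: (@continuous_comp _ _ _ (paraIm L) (fun x => x ^+ 2));
      [exact: cY|exact: exprn_continuous].
have cV : continuous (fun t => (r t)^-1).
  move=> t; apply: cvgV; last exact: cr.
  by rewrite gt_eqF// modulus_para_gt0.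
split => // t; apply: cvgM.
- exact: cX.
- exact: cV.
- exact: cY.
- exact: cV.
Qed.

Lemma continuous_modes L n m : 0 < L -> 0 <= m ->
  continuous (mode_re L n m) /\ continuous (mode_im L n m).
Proof.
move=> L0 m0; have [cr cc cs] := continuous_para L0 m0.
have ce : continuous (fun t => expR (- t ^+ 2) : R).
  move=> t; apply: continuous_comp; last exact: continuous_expR.
  by apply: cvgN; exact: exprn_continuous.
have cK : continuous (fun t => besselK n%:R (modulus (paraRe L m t) (paraIm L t))).
  move=> t; apply: (@continuous_comp _ _ _
    (fun t => modulus (paraRe L m t) (paraIm L t)) (besselK n%:R)); first exact: cr.
  exact: (is_derive_continuous (is_derive_besselK _ (modulus_para_gt0 t L0 m0))).
by split => t; have [hc hs] := cos_mul_continuous n (cc t) (cs t);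
  apply: cvgM; [exact: ce|apply: cvgM; [|exact: cK]|exact: ce|apply: cvgM; [|exact: cK]].
Qed.

Lemma norm_mode_re_le L n m t : 0 < L -> 0 <= m ->
  `|mode_re L n m t| <= besselK n%:R (L ^+ 2) * expR (- t ^+ 2).
Proof.
move=> L0 m0; rewrite normrM (ger0_norm (expR_ge0 _)) mulrC ler_wpM2r ?expR_ge0//.
apply: norm_besselK_mode_le; first exact: exprn_gt0.
by apply: modulus_para_ge => //; exact: ltW.
Qed.

Lemma norm_mode_im_le L n m t : 0 < L -> 0 <= m ->
  `|mode_im L n m t| <= besselK n%:R (L ^+ 2) * expR (- t ^+ 2).
Proof.
move=> L0 m0; rewrite /mode_im normrM (ger0_norm (expR_ge0 _)) mulrC.
rewrite ler_wpM2r ?expR_ge0//.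
have rm := modulus_para_ge t (ltW L0) m0.
rewrite normrM (ger0_norm (besselK_ge0 _ _)).
rewrite (le_trans _ (le_besselK n%:R (exprn_gt0 2 L0) rm))// ler_piMl ?besselK_ge0//.
by apply/norm_sin_mul_le1/unit_direction; exact: modulus_para_gt0.
Qed.

Lemma integrable_expRN_sqr (c : R) :
  mu.-integrable setT (EFin \o (fun t => c * expR (- t ^+ 2))).
Proof.
apply: integrable_EFinZ.
have := @integrable_gaussian R 1 0 ltr01.
by under eq_fun do rewrite mul1r subr0.
Qed.

Lemma integrable_modes L n m : 0 < L -> 0 <= m ->
  mu.-integrable setT (EFin \o mode_re L n m) /\
  mu.-integrable setT (EFin \o mode_im L n m).
Proof.
move=> L0 m0; have [cr ci] := continuous_modes n L0 m0.
split; apply: (continuous_integrable_dom _ _ (integrable_expRN_sqr (besselK n%:R (L ^+ 2)))) => // t.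
- exact: norm_mode_re_le.
- exact: norm_mode_im_le.
Qed.

Lemma mode_imN L n m t : mode_im L n m (- t) = - mode_im L n m t.
Proof.
have eY : paraIm L (- t) = - paraIm L t by rewrite /paraIm; ring.
have eX : paraRe L m (- t) = paraRe L m t by rewrite /paraRe sqrrN.
rewrite /mode_im eX eY modulusN sqrrN mulNr.
by rewrite (cos_mulNs _ _ _).2; ring.
Qed.

Lemma Rintegral_odd (f : R -> R) : mu.-integrable setT (EFin \o f) ->
  (forall t, f (- t) = - f t) -> \int[mu]_t f t = 0.
Proof.
move=> fi fN; have mf : measurable_fun setT f.
  by apply/measurable_EFinP; exact: measurable_int fi.
(* Reflection is available for nonnegative functions only, so it is applied to [|f| + f]; the
   integral of [|f|] then cancels. *)
pose g (t : R) : R := `|f t| + f t.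
have mg : measurable_fun setT g.
  by apply: measurable_funD => //; exact: measurableT_comp.
have g0 t : 0 <= g t by rewrite /g -lerBlDr sub0r -normrN ler_norm.
have ai : mu.-integrable setT (EFin \o (fun t => `|f t|)) by exact: integrable_norm.
have := integral_reflection mg g0 => /(congr1 fine).
rewrite -/(Rintegral mu setT (fun t => g (- t))) -/(Rintegral mu setT g).
have -> : \int[mu]_t g t = \int[mu]_t `|f t| + \int[mu]_t f t by exact: RintegralD.
have -> : \int[mu]_t g (- t) = \int[mu]_t `|f t| - \int[mu]_t f t.
  rewrite -RintegralB//; apply: eq_Rintegral => t _.
  by rewrite /g fN normrN.
have aux (a b : R) : a - b = a + b -> b = 0 by lra.
exact: aux.
Qed.

Lemma Rintegral_mode_im L n m : 0 < L -> 0 <= m -> \int[mu]_t mode_im L n m t = 0.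
Proof.
move=> L0 m0; apply: Rintegral_odd; last by move=> t; exact: mode_imN.
by have [] := integrable_modes n L0 m0.
Qed.

(** This is [F_n]; the parameter of the theorem is called [m] because [mu] denotes Lebesgue measure
    here. *)
Definition mode_integral L n m := \int[mu]_t mode_re L n m t.

Lemma is_derive_paraRe L m t : is_derive m 1 (fun m => paraRe L m t) (- 1 : R).
Proof.
apply: (is_derive_eq (is_derive_add (is_derive_const _ m) (is_derive_opp (is_derive_id m 1)))).
by rewrite add0r.
Qed.

Lemma is_derive_mode_integralS L n m : 0 < L -> 0 < m ->
  is_derive m 1 (mode_integral L n.+1)
    ((mode_integral L n m + mode_integral L n.+2 m) / 2).
Proof.
move=> L0 m0.
have i k z (z0 : 0 <= z) := (integrable_modes k L0 z0).1.
pose f' z t := 2^-1 * (mode_re L n z t + mode_re L n.+2 z t).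
have -> : (mode_integral L n m + mode_integral L n.+2 m) / 2 = \int[mu]_t f' m t.
  rewrite mulrC /mode_integral -RintegralD//; [|exact/i/ltW|exact/i/ltW].
  rewrite -RintegralZl//; last by apply: integrable_EFinD; exact/i/ltW.
(* [K_n] decreases and the modulus is at least [L ^ 2], so this bounds the Bessel factors for all
   [t] and all positive parameters. *)
pose B := 2^-1 * (besselK n%:R (L ^+ 2) + besselK n.+2%:R (L ^+ 2)).
apply: (@is_derive_under_integral _ (fun z t => mode_re L n.+1 z t) f'
  (fun t => B * expR (- t ^+ 2)) m 0 (2 * m)).
- by apply/andP; split; lra.
- by move=> z /andP[z0 _]; apply/i/ltW.
- move=> z t /andP[z0 _].
  apply: (is_derive_eq (is_derive_scale _ (is_derive_chain (is_derive_paraRe L z t)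
    (is_derive_besselK_modeS n (modulus_para_gt0 t L0 (ltW z0)))))).
  by rewrite /f' /mode_re; field.
- by move=> t; rewrite mulr_ge0 ?expR_ge0// mulr_ge0 ?invr_ge0// addr_ge0 ?besselK_ge0.
- exact: integrable_expRN_sqr.
- move=> z t /andP[z0 _]; rewrite /f' /B -mulrA normrM ger0_norm ?invr_ge0//.
  rewrite ler_pM2l ?invr_gt0// mulrDl (le_trans (ler_normD _ _))//.
  by rewrite lerD// norm_mode_re_le// ltW.
Qed.

Lemma is_derive_mode_integral0 L m : 0 < L -> 0 < m ->
  is_derive m 1 (mode_integral L 0) (mode_integral L 1 m).
Proof.
move=> L0 m0.
have i k z (z0 : 0 <= z) := (integrable_modes k L0 z0).1.
apply: (@is_derive_under_integral _ (fun z t => mode_re L 0 z t)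
  (fun z t => mode_re L 1 z t)
  (fun t => besselK 1%:R (L ^+ 2) * expR (- t ^+ 2)) m 0 (2 * m)).
- by apply/andP; split; lra.
- by move=> z /andP[z0 _]; apply/i/ltW.
- move=> z t /andP[z0 _].
  apply: (is_derive_eq (is_derive_scale _ (is_derive_chain (is_derive_paraRe L z t)
    (is_derive_besselK_mode0 (modulus_para_gt0 t L0 (ltW z0)))))).
  by rewrite /mode_re; ring.
- by move=> t; rewrite mulr_ge0 ?expR_ge0 ?besselK_ge0.
- exact: integrable_expRN_sqr.
- by move=> z t /andP[z0 _]; rewrite norm_mode_re_le// ltW.
Qed.

(** A derivative at [m > 0] only sees values near [m], so a formula known on the positive half-line
    is enough. *)
Lemma is_derive_pos_eq_expRN (f : R -> R) (C m d : R) : 0 < m ->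
  (forall x, 0 < x -> f x = C * expR (- x)) -> is_derive m 1 f d ->
  d = - (C * expR (- m)).
Proof.
move=> m0 fE [_ <-].
have : is_derive m 1 (fun x => C * expR (- x)) (- (C * expR (- m))).
  apply: (is_derive_eq (is_derive_scale C (is_derive_exp_comp
    (is_derive_opp (is_derive_id m 1))))).
  by ring.
move=> [_ <-]; apply: near_eq_derive => //.
near=> x; apply: fE; near: x; exact: lt_nbhsr.
Unshelve. all: by end_near. Qed.

(** [F_1 = F_0'] and [F_(n+2) = 2 F_(n+1)' - F_n] determine every order from [F_0]. *)
Lemma mode_integralE L C : 0 < L ->
  (forall m, 0 < m -> mode_integral L 0 m = C * expR (- m)) ->
  forall n m, 0 < m -> mode_integral L n m = (-1) ^+ n * C * expR (- m).
Proof.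
move=> L0 h0 n.
(* The relation has two steps, so the induction carries two consecutive orders. *)
suff [] : (forall m, 0 < m -> mode_integral L n m = (-1) ^+ n * C * expR (- m)) /\
  (forall m, 0 < m -> mode_integral L n.+1 m = (-1) ^+ n.+1 * C * expR (- m)) by [].
elim: n => [|n [IH1 IH2]].
  split=> m m0; first by rewrite h0// mul1r.
  rewrite (is_derive_pos_eq_expRN m0 h0 (is_derive_mode_integral0 L0 m0)).
  by rewrite expr1; ring.
split=> // m m0.
have := is_derive_pos_eq_expRN m0 IH2 (is_derive_mode_integralS n L0 m0).
by rewrite IH1// !exprS => h; lra.
Qed.

End mode_integrals.

(** * The case [v = 0]: Gaussian integration after Tonelli *)

Section mode0.
Context {R : realType}.
Local Notation mu := (@lebesgue_measure R).
Implicit Types (L m q t x : R).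

(** If the integral were 0, [f] would vanish almost everywhere; as it vanishes nowhere, a null set
    would contain [[0, 1]]. *)
Lemma Rintegral_gt0 (f : R -> R) : mu.-integrable setT (EFin \o f) ->
  (forall x, 0 < f x) -> 0 < \int[mu]_x f x.
Proof.
move=> fi f0; have f_ge0 x : 0 <= f x by exact: ltW.
rewrite lt_neqAle Rintegral_ge0 ?andbT//; apply/eqP => h.
have mf : measurable_fun setT (EFin \o f) := measurable_int mu fi.
have E : (\int[mu]_x `|(EFin \o f) x| = 0)%E.
  under eq_integral do rewrite /= ger0_norm//.
  rewrite -[LHS]fineK; last exact: integrable_fin_num.
  by rewrite -/(Rintegral mu setT f) -h.
have [A [mA A0 sA]] : ae_eq mu setT (EFin \o f) (cst 0%E).
  by apply/ae_eq_integral_abs.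
have sub : `[0%R, 1%R]%classic `<=` A.
  move=> x _; apply: sA => /= /(_ I) [fx].
  by have := f0 x; rewrite fx ltxx.
have : (mu `[0%R, 1%R]%classic <= mu A)%E by apply: le_measure; rewrite ?inE.
rewrite A0 lebesgue_measure_itv/= lte_fin ltr01 sube0 lee_fin.
by rewrite ler10.
Qed.

Lemma modulus_para_factor L q t :
  modulus (paraRe L (q ^+ 2) t) (paraIm L t) =
  Num.sqrt ((t - q) ^+ 2 + L ^+ 2) * Num.sqrt ((t + q) ^+ 2 + L ^+ 2).
Proof.
rewrite -sqrtrM ?addr_ge0 ?sqr_ge0//; congr Num.sqrt.
by rewrite /paraRe /paraIm; ring.
Qed.

(* Translating by [ln (a / b)] in [K_0 (a b)] decouples the two factors. *)
Lemma integral_besselK_integrand_factor (a b : R) : 0 < a -> 0 < b ->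
  (\int[mu]_x (besselK_integrand 0 (a * b) x)%:E =
   \int[mu]_x (expR (- ((a ^+ 2 * expR x + b ^+ 2 * expR (- x)) / 2)))%:E)%E.
Proof.
move=> a0 b0.
rewrite -(@integral_translation _ (besselK_integrand 0 (a * b)) (ln (a / b))).
- apply: eq_integral => x _; congr EFin; rewrite /besselK_integrand; congr expR.
  rewrite opprD !expRD lnK ?posrE ?divr_gt0// -lnV ?posrE ?divr_gt0//.
  rewrite lnK ?posrE ?invr_gt0 ?divr_gt0//.
  by field; rewrite !gt_eqF.
- exact: continuous_besselK_integrand.
- by move=> x; exact/ltW/besselK_integrand_gt0.
Qed.

Definition mode0_kernel L q t x :=
  expR (- t ^+ 2) * expR (- ((((t - q) ^+ 2 + L ^+ 2) * expR x +
     ((t + q) ^+ 2 + L ^+ 2) * expR (- x)) / 2)).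

(** With [|z| = a b] decoupled, only [a ^ 2] and [b ^ 2] remain: the square roots disappear and the
    exponent is quadratic in [t]. *)
Lemma mode_re0E L q t : 0 < L ->
  ((mode_re L 0 (q ^+ 2) t)%:E = \int[mu]_x (2^-1 * mode0_kernel L q t x)%:E)%E.
Proof.
move=> L0.
set A := (t - q) ^+ 2 + L ^+ 2; set B := (t + q) ^+ 2 + L ^+ 2.
have A0 : 0 < A by rewrite ltr_wpDl ?sqr_ge0 ?exprn_gt0.
have B0 : 0 < B by rewrite ltr_wpDl ?sqr_ge0 ?exprn_gt0.
have i := @integrable_besselK_integrand R 0 _ (modulus_para_gt0 t L0 (sqr_ge0 q)).
rewrite /mode_re /besselK_mode cos_mul0 mul1r besselKE mulrCA !EFinM.
rewrite /Rintegral fineK; last exact: integrable_fin_num.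
rewrite modulus_para_factor integral_besselK_integrand_factor ?sqrtr_gt0//.
rewrite !sqr_sqrtr ?(ltW A0) ?(ltW B0)//.
have mE : measurable_fun setT (fun x => expR (- ((A * expR x + B * expR (- x)) / 2))).
  apply: measurableT_comp => //; apply: measurableT_comp => //.
  apply: measurable_funM => //; apply: measurable_funD; apply: measurable_funM => //.
  by apply: measurableT_comp.
rewrite -ge0_integralZl//; last exact/measurable_EFinP.
rewrite -ge0_integralZl//.
  apply: emeasurable_funM => //; exact/measurable_EFinP.
Qed.

(** This is [1 + cosh x], the coefficient of [- t ^ 2] in the exponent of [mode0_kernel]. *)
Definition mode0_width x := (expR x + 1) ^+ 2 / (2 * expR x).

Lemma mode0_width_ge1 x : 1 <= mode0_width x.
Proof.
have e0 := expR_gt0 x; rewrite ler_pdivlMr; last by lra.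
by have := sqr_ge0 (expR x); lra.
Qed.

(** What the integral in [t] leaves besides [exp (- q ^ 2)]; it is free of [q], and its integral is
    the constant [C']. *)
Definition mode0_density L x :=
  2^-1 * (Num.sqrt (pi / mode0_width x) * besselK_integrand 0 (L ^+ 2) x).

Lemma integral_mode0_kernel L q x :
  (\int[mu]_t (2^-1 * mode0_kernel L q t x)%:E =
   (expR (- q ^+ 2) * mode0_density L x)%:E)%E.
Proof.
have w0 : 0 < mode0_width x by exact: lt_le_trans (mode0_width_ge1 x).
have e0 := expR_gt0 x.
(* The centre [q tanh (x / 2)] completes the square in [t]. The leftover coefficient of [q ^ 2] is
   [cosh x - sinh x ^ 2 / (1 + cosh x) = 1], so [exp (- q ^ 2)] separates from [x]. *)
pose p := q * (expR x - 1) / (expR x + 1).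
have E t : 2^-1 * mode0_kernel L q t x = 2^-1 * (expR (- q ^+ 2) *
    besselK_integrand 0 (L ^+ 2) x) * expR (- (mode0_width x * (t - p) ^+ 2)).
  rewrite -mulrA; congr (_ * _).
  rewrite /mode0_kernel /besselK_integrand -!expRD; congr expR.
  rewrite expRN /mode0_width /p; field.
  by rewrite !gt_eqF//; lra.
under eq_integral do rewrite E EFinM.
rewrite integralZl//; last exact: integrable_gaussian.
by rewrite integral_gaussian// -EFinM; congr EFin; rewrite /mode0_density; ring.
Qed.

Lemma mode0_density_gt0 L x : 0 < mode0_density L x.
Proof.
have w0 : 0 < mode0_width x by exact: lt_le_trans (mode0_width_ge1 x).
by rewrite mulr_gt0 ?invr_gt0// mulr_gt0 ?besselK_integrand_gt0// sqrtr_gt0 divr_gt0// pi_gt0.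
Qed.

Lemma integrable_mode0_density L : 0 < L ->
  mu.-integrable setT (EFin \o mode0_density L).
Proof.
move=> L0; have w0 x : 0 < mode0_width x by exact: lt_le_trans (mode0_width_ge1 x).
have cw : continuous mode0_width.
  move=> x; have dw : is_derive x 1 mode0_width
      ((expR x + 1) * (expR x - 1) / (2 * expR x)).
    have en : 2 * expR x != 0 by rewrite gt_eqF// mulr_gt0// expR_gt0.
    apply: is_derive_eq; rewrite /GRing.scale/=.
    by field; rewrite gt_eqF// expR_gt0.
  exact: is_derive_continuous dw.
have cd : continuous (mode0_density L).
  move=> x; apply: cvgM; first exact: cvg_cst.
  apply: cvgM; last exact: continuous_besselK_integrand.
  apply: (@continuous_comp _ _ _ (fun x => pi / mode0_width x) Num.sqrt); last first.
    exact: sqrt_continuous.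
  apply: cvgM; first exact: cvg_cst.
  by apply: cvgV; [rewrite gt_eqF|exact: cw].
(* Since [mode0_width x >= 1], the square root is at most [sqrt pi]. *)
apply: (continuous_integrable_dom (g := fun x =>
    2^-1 * Num.sqrt pi * besselK_integrand 0 (L ^+ 2) x) cd).
  move=> x; rewrite gtr0_norm ?mode0_density_gt0// /mode0_density mulrA.
  rewrite ler_pM2r ?besselK_integrand_gt0// ler_pM2l ?invr_gt0// ler_wsqrtr//.
  by rewrite ler_pdivrMr// ler_peMr ?pi_ge0// mode0_width_ge1.
by apply: integrable_EFinZ; apply: integrable_besselK_integrand; exact: exprn_gt0.
Qed.

Lemma measurable_mode0_kernel L q :
  measurable_fun setT (fun z : R * R => (2^-1 * mode0_kernel L q z.1 z.2)%:E).
Proof.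
have m1 : measurable_fun setT (@fst R R) by exact: measurable_fst.
have m2 : measurable_fun setT (@snd R R) by exact: measurable_snd.
apply/measurable_EFinP; apply: measurable_funM => //; apply: measurable_funM.
  apply: measurableT_comp => //; apply: measurableT_comp => //.
  exact: measurable_funX.
apply: measurableT_comp => //; apply: measurableT_comp => //.
apply: measurable_funM => //; apply: measurable_funD; apply: measurable_funM.
- apply: measurable_funD => //; apply: measurable_funX.
  exact: measurable_funB.
- exact: measurableT_comp.
- apply: measurable_funD => //; apply: measurable_funX.
  exact: measurable_funD.
- by apply: measurableT_comp => //; exact: measurableT_comp.
Qed.

Lemma mode_integral0E L m : 0 < L -> 0 < m ->
  mode_integral L 0 m = (\int[mu]_x mode0_density L x) * expR (- m).
Proof.
move=> L0 m0; have i := integrable_mode0_density L0.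
have -> : m = Num.sqrt m ^+ 2 by rewrite sqr_sqrtr// ltW.
set q := Num.sqrt m.
rewrite mulrC /mode_integral -RintegralZl// /Rintegral; congr fine.
under eq_integral do rewrite mode_re0E//.
(* Tonelli applies because the kernel is nonnegative; the inner integral is now the Gaussian one. *)
transitivity (\int[mu]_x \int[mu]_t (2^-1 * mode0_kernel L q t x)%:E)%E.
  apply: (@fubini_tonelli _ _ _ _ _ mu mu
    (fun z : R * R => (2^-1 * mode0_kernel L q z.1 z.2)%:E)).
  - exact: measurable_mode0_kernel.
  - by move=> z; rewrite lee_fin mulr_ge0 ?invr_ge0// mulr_ge0 ?expR_ge0.
by apply: eq_integral => x _; rewrite integral_mode0_kernel.
Qed.

End mode0.

(** * Real and imaginary parts of the complex integrand *)

Section complex_integrand.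
Context {R : realType}.
Local Notation mu := (@lebesgue_measure R).
Implicit Types (L m t x y : R) (n : nat).

Lemma complex_real_div x y (r : R) : (x +i* y) / r%:C = (x / r) +i* (y / r).
Proof. by rewrite -fmorphV; apply/eqP; rewrite eq_complex/= !mulr0 subr0 add0r !eqxx. Qed.

Lemma unit_complex_inv (c s : R) : c ^+ 2 + s ^+ 2 = 1 ->
  (c +i* s)^-1 = c +i* (- s).
Proof. by move=> cs; apply/eqP; rewrite eq_complex/= cs !divr1 !eqxx. Qed.

Lemma para_complexE L m t :
  (t +i* L) ^+ 2 - m%:C = paraRe L m t +i* paraIm L t :> R[i].
Proof.
by apply/eqP; rewrite eq_complex expr2/= /paraRe /paraIm; apply/andP; split; apply/eqP; ring.
Qed.

(** On the unit circle the inverse is the conjugate and [K_v] is even in [v], so a negative order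
    only flips the sign of the imaginary part. *)
Lemma integrand_modeE L m (v : int) t : 0 < L -> 0 < m ->
  let z : R[i] := (t +i* L) ^+ 2 - m%:C in
  (expR (- t ^+ 2))%:C * (z / `|z|) ^ v * (besselK v%:~R (complex.Re `|z|))%:C =
  mode_re L `|v|%N m t +i* ((-1) ^+ (v < 0)%R * mode_im L `|v|%N m t).
Proof.
move=> L0 m0 z; rewrite /z {z} para_complexE normc_def/=.
have r0 := modulus_para_gt0 t L0 (ltW m0).
rewrite -/(modulus (paraRe L m t) (paraIm L t)) complex_real_div.
have cs := unit_direction r0.
rewrite /mode_re /mode_im /besselK_mode.
set r := modulus _ _ in r0 cs *; set c := _ / r in cs *; set s := _ / r in cs *.
have main n (s' : R) : (expR (- t ^+ 2))%:C * (c +i* s') ^+ n * (besselK n%:R r)%:C =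
  (expR (- t ^+ 2) * (cos_mul n c s' * besselK n%:R r)) +i*
  (expR (- t ^+ 2) * (sin_mul n c s' * besselK n%:R r)).
  rewrite /cos_mul /sin_mul; case: (_ ^+ n) => a b /=.
  by apply/eqP; rewrite eq_complex/=; apply/andP; split; apply/eqP; ring.
case: v => n /=.
  by rewrite -exprnP -pmulrn main mul1r.
have -> : (Negz n)%:~R = - n.+1%:R :> R by rewrite NegzE mulrNz -pmulrn.
rewrite besselKN -[_ ^ Negz n]/((_ ^+ n.+1)^-1) -exprVn unit_complex_inv// main.
have [-> ->] := cos_mulNs n.+1 c s.
by rewrite expr1 mulN1r mulNr mulrN.
Qed.

End complex_integrand.

(** * Assembly: the constant found at [v = 0] serves every integer order *)

Theorem theoremA1 (R : realType) (lambda : R) (lambda_gt0 : 0 < lambda) :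
  exists C' : R, 0 < C' /\
    forall (v : int) (mu : R), 0 < mu ->
      let z (t : R) : R[i] := (t +i* (lambda ^+ 2)) ^+ 2 - mu%:C in
      let f (t : R) : R[i] :=
        (expR (- t ^+ 2))%:C * (z t / `|z t|) ^ v
          * (besselK v%:~R (complex.Re `|z t|))%:C in
      cintegrable (@lebesgue_measure R) setT f /\
      cintegral (@lebesgue_measure R) setT f =
        (-1) ^ v * C'%:C * (expR (- mu))%:C.
Proof.
set L := lambda ^+ 2; have L0 : 0 < L by exact: exprn_gt0.
exists (\int[@lebesgue_measure R]_x mode0_density L x); split.
  apply: Rintegral_gt0; first exact: integrable_mode0_density.
  exact: mode0_density_gt0.
move=> v m m0 z f.
have fE : f = fun t => mode_re L `|v|%N m t +i* ((-1) ^+ (v < 0)%R * mode_im L `|v|%N m t).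
  by apply/funext => t; exact: integrand_modeE.
have [ir ii] := integrable_modes `|v|%N L0 (ltW m0).
rewrite fE; split.
  by split => //=; exact: integrable_EFinZ.
rewrite /cintegral/= -/(mode_integral L `|v|%N m).
rewrite (mode_integralE L0 (fun m m0 => mode_integral0E L0 m0))//.
have -> : \int[@lebesgue_measure R]_t ((-1) ^+ (v < 0)%R * mode_im L `|v|%N m t) = 0.
  by rewrite RintegralZl// Rintegral_mode_im ?mulr0// ltW.
(* As -1 is its own inverse, the sign depends only on [|v|]. *)
have -> : (-1) ^ v = ((-1) ^+ `|v|%N)%:C :> R[i].
  rewrite rmorphXn rmorphN1; case: v {z f fE ir ii} => // n.
  by rewrite -[LHS]/(((-1) ^+ n.+1)^-1) -exprVn invrN1.
by rewrite -!rmorphM.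
Qed.
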